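(* Fix a function $f\colon[0,1]\to\mathbb{R}$. Let $D$ be a Cantor set in $[0,1]$ with $\{0,1\}\subset D$, and let $(W_n)_{n\in\mathbb{N}}$ be a one-to-one sequence of all connected components of $[0,1]\setminus D$. Then $f$ is in $C^\infty[0,1]$ with $D\subset E(f)$ if and only if the following conditions hold simultaneously: (i) $f|_D=0$, the functions $f|_{\operatorname{cl}(W_n)}$, $n\in\mathbb{N}$, are in $C^\infty(\operatorname{cl}(W_n))$, and the series $\sum_n\chi_{\operatorname{cl}(W_n)}f^{(p)}$, for $p\ge 0$, are uniformly convergent on $[0,1]$; (ii) $D\subset\operatorname{cl}\left(\bigcup_{n\in M^-}W_n\right)\cap\operatorname{cl}\left(\bigcup_{n\in M^+}W_n\right)$, where $M^-:=\{n\colon W_n\cap f^{-1}[(-\infty,0)]\neq\emptyset\}$ and $M^+:=\{n\colon W_n\cap f^{-1}[(0,\infty)]\neq\emptyset\}$.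
   Context: A Cantor set in $\mathbb{R}$ is a nonempty, perfect, compact, nowhere dense subset of $\mathbb{R}$. A function $f\colon[0,1]\to\mathbb{R}$ cuts the real axis at a point $x\in[0,1]$ if $f(x)=0$ and in every neighbourhood $U$ of $x$ there exist $y,z\in U$ such that $f(y)<0<f(z)$. The cutting set $E(f)$ is the set of all $x\in[0,1]$ at which $f$ cuts the real axis. $C^\infty[0,1]$ is the vector space of functions $[0,1]\to\mathbb{R}$ that have derivatives of all orders on $[0,1]$, and $C^\infty(P)$ is defined analogously for a compact interval $P$. $\operatorname{cl}$ denotes closure, $\chi_A$ denotes the characteristic function of a set $A$, and $f^{(p)}$ denotes the $p$-th derivative of $f$, with $f^{(0)}=f$.
   Formalization: In (i), f^(p) is the derivative of f on [0,1] and is required to exist at all points of each cl(W_n), endpoints included; with only the one-sided derivatives of f restricted to cl(W_n) the ''if'' part fails, e.g. f=(x-a)(b-x) on one gap (a,b). *)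

(* Defs.v *)
From HB Require Import structures.
From mathcomp Require Import all_boot all_order all_algebra.
From mathcomp Require Import all_classical all_reals all_analysis.

Set Implicit Arguments.
Unset Strict Implicit.
Unset Printing Implicit Defensive.

Import Order.TTheory GRing.Theory Num.Theory.
Import numFieldNormedType.Exports.

Local Open Scope classical_set_scope.
Local Open Scope ring_scope.

(* A function A -> R is represented by a total function R -> R; the notions
   below depend only on its values on A. *)

Definition unitI (R : realType) : set R := `[0, 1].

Definition cantor_set (R : realType) (D : set R) : Prop :=
  [/\ D !=set0, perfect_set D, compact D & interior (closure D) = set0].

Definition quotient_within (R : realType) (A : set R) (f : R -> R) (x : R) :
    set_system R :=
  (f y - f x) / (y - x) @[y --> within A x^'].

Definition derive_within (R : realType) (A : set R) (f : R -> R) : R -> R :=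
  fun x => lim (quotient_within A f x).

(* The p-th derivative of f relative to A (one-sided at the endpoints when A is
   an interval).  Its value at x is meaningful only if [nderivable_within]. *)
Definition nderive_within (R : realType) (A : set R) (p : nat) (f : R -> R) :
    R -> R :=
  iter p (derive_within A) f.

(* The p-th derivative of f relative to A exists at x: as usual, the derivative
   of order p.+1 at x requires the one of order p on a relative neighbourhood
   of x. *)
Fixpoint nderivable_within (R : realType) (A : set R) (p : nat) (f : R -> R)
    (x : R) : Prop :=
  if p is q.+1 then
    (\forall y \near within A (nbhs x), nderivable_within A q f y) /\
    cvg (quotient_within A (nderive_within A q f) x)
  else True.

Definition smooth_on (R : realType) (P : set R) (f : R -> R) : Prop :=
  forall p x, P x -> nderivable_within P p f x.

Definition cuts_at (R : realType) (f : R -> R) (x : R) : Prop :=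
  f x = 0 /\
  forall U, within (@unitI R) (nbhs x) U ->
    exists y z, [/\ (U `&` @unitI R) y, (U `&` @unitI R) z, f y < 0 & 0 < f z].

Definition cutting_set (R : realType) (f : R -> R) : set R :=
  [set x | @unitI R x /\ cuts_at f x].

(* Uniform convergence on [0,1] of the series of the functions
   \chi_(cl W_n) f^(p).  Here f^(p) is the derivative of f : [0,1] -> R, so at an
   endpoint of W_n it is the derivative of f relative to [0,1], not the
   one-sided derivative of the restriction of f to cl W_n; the terms of the
   series make sense only if f^(p) exists on each cl W_n. *)
Definition unif_cvg_derive_series (R : realType) (W : nat -> set R)
    (f : R -> R) (p : nat) : Prop :=
  (forall n x, closure (W n) x -> nderivable_within (@unitI R) p f x) /\
  exists g : R -> R,
    {uniform @unitI R,
      (fun N x => \sum_(0 <= n < N)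
         \1_(closure (W n)) x * nderive_within (@unitI R) p f x) @ \oo --> g}.

(* Main.v *)
Require Import Defs.
From HB Require Import structures.
From mathcomp Require Import all_boot all_order all_algebra.
From mathcomp Require Import all_classical all_reals all_analysis.
From mathcomp Require Import lra.

(* The complementary gaps W_n are open intervals with endpoints in D.

   If f is smooth and vanishes on D then, D having no isolated points, every
   f^(p) vanishes on D.  Hence the N-th partial sum of the series is f^(p) on the
   first N gaps and 0 on the others, which is uniformly close to f^(p) by
   continuity and compactness of [0,1].

   Conversely one proves by induction on p that f^(p) exists and vanishes on D.
   On the closure of a gap existence is assumed.  At any other point x of D, a
   gap close to x has a large index, so f^(p+1) is uniformly small on it by
   uniform convergence; the mean value theorem from the end of the gap facing x,
   where f^(p) vanishes, shows that f^(p) has derivative 0 at x.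

   Condition (ii) only says that near each d in D there is a gap with a point
   where f < 0 (or f > 0), not that this point is near d.  But D has three points
   d1 < d2 < d3 near x, and a gap meeting ]d1, d3[ is contained in it. *)

Set Implicit Arguments.
Unset Strict Implicit.
Unset Printing Implicit Defensive.

Import Order.TTheory GRing.Theory Num.Theory.
Import numFieldNormedType.Exports.

Local Open Scope classical_set_scope.
Local Open Scope ring_scope.

(** * Limit points of a set and of open intervals *)

Lemma within_dnbhs_proper (T : topologicalType) (A : set T) (x : T) :
  limit_point A x -> ProperFilter (within A x^').
Proof.
move=> Ax; apply: Build_ProperFilter_ex => U.
by move=> /Ax[y [yx Ay /(_ yx Ay) ?]]; exists y.
Qed.

Lemma limit_pointS (T : topologicalType) (A B : set T) :
  A `<=` B -> limit_point A `<=` limit_point B.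
Proof. by move=> AB x Ax U /Ax[y [yx /AB By Uy]]; exists y. Qed.

Section itvoo.
Context {R : realType}.
Implicit Types a b x : R.

Lemma limit_point_itvoo a b x : a < b -> a <= x <= b ->
  limit_point `]a, b[%classic x.
Proof.
move=> ab /andP[ax xb] U /nbhs_ballP[e /= e0 eU].
have [xltb|blex] := ltP x b.
(* Half of the smaller of [e] and [b - x] keeps the point both in the ball and to the left of [b];
   when [x = b] the step is taken to the left instead. *)
- exists (x + Num.min e (b - x) / 2).
  have m0 : 0 < Num.min e (b - x) by rewrite lt_min e0 subr_gt0.
  have [me mb] : Num.min e (b - x) <= e /\ Num.min e (b - x) <= b - x.
    by rewrite !ge_min !lexx orbT.
  split; first by rewrite gt_eqF//; lra.
    by rewrite /= in_itv /=; apply/andP; split; lra.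
  by apply: eU; rewrite /ball/= ltr_norml; apply/andP; split; lra.
- exists (x - Num.min e (x - a) / 2).
  have m0 : 0 < Num.min e (x - a) by rewrite lt_min e0 subr_gt0 (lt_le_trans ab).
  have [me mb] : Num.min e (x - a) <= e /\ Num.min e (x - a) <= x - a.
    by rewrite !ge_min !lexx orbT.
  split; first by rewrite lt_eqF//; lra.
    by rewrite /= in_itv /=; apply/andP; split; lra.
  by apply: eU; rewrite /ball/= ltr_norml; apply/andP; split; lra.
Qed.

Lemma closure_itvoo a b : a < b -> closure `]a, b[%classic = `[a, b]%classic.
Proof.
move=> ab; apply/seteqP; split; first exact: itv_closure.
move=> x /=; rewrite in_itv/= => abx.
exact/subset_limit_point/limit_point_itvoo.
Qed.

End itvoo.

(** * Derivatives relative to a set *)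

Section quotient_within.
Context {R : realType}.
Implicit Types (A B : set R) (f : R -> R) (x : R).

(** Shrinking the set keeps the limit, and since [x] is a limit point of [B] the smaller filter is
    proper, so [lim] returns that same value. *)
Lemma quotient_withinS A B f x : B `<=` A -> limit_point B x ->
  cvg (quotient_within A f x) ->
  cvg (quotient_within B f x) /\ derive_within B f x = derive_within A f x.
Proof.
move=> BA Bx Af; have PB := within_dnbhs_proper Bx.
have Bf : quotient_within B f x --> derive_within A f x.
  by apply: cvg_trans Af; apply: cvg_app; exact: within_subset.
by split; [exact: cvgP Bf | exact: (cvg_lim (@norm_hausdorff _ _) Bf)].
Qed.

(** For [y != x], [f y] is [f x] plus the quotient times [y - x], and the last factor tends to 0. *)
Lemma quotient_within_continuous A f x : cvg (quotient_within A f x) ->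
  f y @[y --> within A (nbhs x)] --> f x.
Proof.
move=> Af.
have : f x + (f y - f x) / (y - x) * (y - x) @[y --> within A x^']
    --> f x + lim (quotient_within A f x) * (x - x).
  apply: cvgD; first exact: cvg_cst.
  apply: cvgM => //; apply: cvgB; last exact: cvg_cst.
  exact: (cvg_trans (cvg_within _) (cvg_within _)).
rewrite subrr mulr0 addr0 => /cvgrPdist_lt Hf.
apply/cvgrPdist_lt => e e0; have := Hf e e0; rewrite !near_withinE => He.
near=> y => Ay; have [->|yx] := eqVneq y x; first by rewrite subrr normr0.
have : y != x -> A y -> `|f x - (f x + (f y - f x) / (y - x) * (y - x))| < e.
  by near: y.
move=> /(_ yx Ay); rewrite divfK ?subr_eq0//.
by rewrite (addrC _ (f y - f x)) subrK.
Unshelve. all: by end_near. Qed.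

(** The derivative can be computed along [B], where all quotients are 0. With [B] the Cantor set,
    this passes vanishing on [D] from one order to the next. *)
Lemma derive_within_eq0 A B f x : B `<=` A -> limit_point B x -> B x ->
  (forall y, B y -> f y = 0) -> cvg (quotient_within A f x) ->
  derive_within A f x = 0.
Proof.
move=> BA Bx xB f0 /(quotient_withinS BA Bx)[_ <-].
have PB := within_dnbhs_proper Bx.
apply: (cvg_lim (@norm_hausdorff _ _)); apply: cvg_near_cst.
rewrite near_withinE; near=> y => By.
by rewrite !f0// subrr mul0r.
Unshelve. all: by end_near. Qed.

Lemma is_derive_within A f x : A° x -> cvg (quotient_within A f x) ->
  is_derive x 1 f (derive_within A f x).
Proof.
move=> Ax /cvgrPdist_lt Af; apply/is_derive1_caratheodory.
(* The Carathéodory slope function: the quotient, completed at [x] by its limit. *)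
exists (fun z => if z == x then derive_within A f x
                 else (f z - f x) / (z - x)).
split; last by rewrite eqxx.
  move=> z; case: eqVneq => [->|zx]; first by rewrite !subrr mulr0.
  by rewrite divfK// subr_eq0.
apply/cvgrPdist_lt => e e0; have := Af e e0; rewrite eqxx !near_withinE => He.
near=> y; case: eqVneq => [_|yx]; first by rewrite subrr normr0.
have Ay : A y by near: y.
by move: yx Ay; near: y.
Unshelve. all: by end_near. Qed.

(** Inside []a, b[] the relative derivative is the ordinary one, and at the two ends the mean value
    theorem asks only for one-sided continuity. *)
Lemma within_mean_value_bound A (F : R -> R) (a b e : R) :
  a < b -> `[a, b]%classic `<=` A ->
  (forall y, a <= y <= b -> cvg (quotient_within A F y)) ->
  (forall y, a < y < b -> `|derive_within A F y| <= e) ->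
  `|F b - F a| <= e * (b - a).
Proof.
move=> ab abA cF F'e.
have [||c] := @MVT R F (derive_within A F) a b ab.
- move=> y; rewrite in_itv /= => /andP[ay yb]; apply: is_derive_within.
    have : nbhs y `]a, b[%classic.
      by apply: open_nbhs_nbhs; split; [exact: itv_open|rewrite /= in_itv /= ay].
    apply: filterS => z zab; apply: abA; move: zab => /=.
    exact: subset_itv_oo_cc.
  by apply: cF; rewrite !ltW.
- apply/subspace_continuousP => y; rewrite /= in_itv /= => aby.
  apply: cvg_trans (quotient_within_continuous (cF y aby)).
  by apply: cvg_app; exact: within_subset.
- rewrite in_itv /= => cab ->.
  rewrite normrM (gtr0_norm (_ : 0 < b - a)) ?subr_gt0//.
  by apply: ler_wpM2r; [rewrite subr_ge0 ltW | exact: F'e].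
Qed.

End quotient_within.

Lemma eq_quotient_within {R : realType} (A : set R) (f g : R -> R) (x : R) :
  A x -> (forall y, A y -> f y = g y) ->
  quotient_within A f x = quotient_within A g x.
Proof.
move=> Ax fg; rewrite eqEsubset; split; apply: near_eq_cvg;
  by rewrite near_withinE; near=> y => Ay; rewrite !fg.
Unshelve. all: by end_near. Qed.

(** By induction the derivatives of order [p] agree on all of [B], so their quotients along [B]
    agree too, and those are restrictions of convergent quotients along [A]. *)
Lemma nderive_withinS {R : realType} (A B : set R) (f : R -> R) :
  B `<=` A -> (forall x, B x -> limit_point B x) -> smooth_on A f ->
  forall p x, B x -> nderivable_within B p f x /\
    nderive_within B p f x = nderive_within A p f x.
Proof.
move=> BA Blim Af; elim=> [//|p IH] x Bx.
have E := eq_quotient_within Bx (fun y By => (IH y By).2).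
have [_ /(quotient_withinS BA (Blim x Bx))[cq dq]] := Af p.+1 x (BA x Bx).
split; first split.
- by rewrite near_withinE; near=> y => By; exact: (IH y By).1.
- by rewrite E.
- by rewrite /nderive_within !iterS -dq /derive_within E.
Unshelve. all: by end_near. Qed.

(** * Gaps: the components of the complement of [D] in the unit interval *)

Definition gap_sequence {R : realType} (D : set R) (W : nat -> set R) :=
  [/\ forall n, exists a b, [/\ a < b, D a, D b, W n = `]a, b[%classic &
        forall y, W n y -> ~ D y],
      forall y, unitI y -> ~ D y -> exists n, W n y &
      forall n m y, W n y -> W m y -> n = m].

Section gaps.
Context {R : realType} (D : set R).
Hypotheses (cD : closed D) (DI : D `<=` @unitI R) (D0 : D 0) (D1 : D 1).

(** The ends are the last point of [D] before [x] and the first one after it; they exist because [D]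
    is closed and contains 0 and 1. *)
Lemma connected_component_gap x : (@unitI R `\` D) x ->
  exists a b, [/\ D a, D b, a < x < b &
    connected_component (@unitI R `\` D) x = `]a, b[%classic].
Proof.
move=> [/= + nDx]; rewrite /unitI /= in_itv /= => /andP[x0 x1].
pose L := D `&` [set y | y <= x]; pose U := D `&` [set y | x <= y].
have L0 : L !=set0 by exists 0.
have U0 : U !=set0 by exists 1.
have Lub : has_ubound L by exists x => y [].
have Ulb : has_lbound U by exists x => y [].
have Da : D (sup L).
  rewrite [D](closure_id _).1//.
  by apply: (@closureS _ L) (closure_sup L0 Lub) => y [].
have Db : D (inf U).
  rewrite [D](closure_id _).1// => V /nbhs_ballP[e /= e0 eV].
  have [y Uy ye] := inf_adherent e0 (conj U0 Ulb).
  exists y; split; first by case: Uy.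
  have yi := ge_inf Ulb Uy; apply: eV.
  by rewrite /ball/= ltr_norml; apply/andP; split; lra.
have ax : sup L < x.
  rewrite lt_neqAle; apply/andP; split; last by apply: ge_sup => // y [].
  by apply: contra_notN nDx => /eqP <-.
have xb : x < inf U.
  rewrite lt_neqAle; apply/andP; split; last by apply: lb_le_inf => // y [].
  by apply: contra_notN nDx => /eqP ->.
have ab y : sup L < y -> y < inf U -> ~ D y.
  move=> ay yb Dy; have [yx|/ltW xy] := leP y x.
    by have := ub_le_sup Lub (conj Dy yx); rewrite leNgt ay.
  by have := ge_inf Ulb (conj Dy xy); rewrite leNgt yb.
exists (sup L), (inf U); split => //; first by rewrite ax xb.
apply/seteqP; split => y /=.
  have /connected_intervalP itv := @component_connected _ (@unitI R `\` D) x.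
  have Ix : connected_component (@unitI R `\` D) x x.
    by apply: connected_component_refl; split => //=; rewrite /unitI /= in_itv /= x0.
  (* A component reaching beyond one of the ends would, being an interval, contain that end, which
     is in [D]. *)
  move=> Cy; rewrite in_itv /= !ltNge; apply/andP; split; apply/negP => H.
    have := itv _ _ Cy Ix (sup L); rewrite H (ltW ax) => /(_ isT).
    by move=> /connected_component_sub[].
  have := itv _ _ Ix Cy (inf U); rewrite H (ltW xb) => /(_ isT).
  by move=> /connected_component_sub[].
move=> yab.
apply: (@connected_component_max _ _ `]sup L, inf U[%classic) yab.
- by rewrite /= in_itv /= ax xb.
- move=> z /=; rewrite in_itv /= => /andP[az zb]; split; last exact: ab.
  have := DI Da; have := DI Db; rewrite /unitI /= !in_itv /=; lra.
- by apply/connected_intervalP; exact: interval_is_interval.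
Qed.

Lemma gap_sequence_components (W : nat -> set R) :
  injective W ->
  range W = [set connected_component (@unitI R `\` D) x | x in @unitI R `\` D] ->
  gap_sequence D W.
Proof.
move=> Winj WE.
have WC n : exists2 x, (@unitI R `\` D) x &
    connected_component (@unitI R `\` D) x = W n.
  have : range W (W n) by exists n.
  by rewrite WE.
split=> [n|y Iy nDy|n m y].
- have [x IDx xn] := WC n.
  have [a [b [Da Db /andP[ax xb] E]]] := connected_component_gap IDx.
  exists a, b; split => //; first exact: lt_trans xb.
    by rewrite -xn.
  by rewrite -xn => y /connected_component_sub[].
- have : range W (connected_component (@unitI R `\` D) y).
    by rewrite WE; exists y.
  move=> [n _ Wn]; exists n; rewrite Wn.
  exact: connected_component_refl.
- have [x _ xn] := WC n; have [x' _ xm] := WC m.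
  rewrite -xn -xm => /same_connected_component xy /same_connected_component x'y.
  by apply: Winj; rewrite -xn -xm xy x'y.
Qed.

End gaps.

(** * Uniform convergence of series over the gaps *)

Lemma uniform_cvg_distP {R : realType} (A : set R) (u : nat -> R -> R)
    (g : R -> R) :
  {uniform A, u @ \oo --> g} <->
  forall e, 0 < e -> \forall N \near \oo, forall x, A x -> `|g x - u N x| < e.
Proof.
split=> [H e e0|H P /uniform_nbhs[E [entE EP]]].
  apply: (H [set h | forall y, A y -> `|g y - h y| < e]).
  apply/uniform_nbhs; exists [set xy | ball xy.1 e xy.2].
  by split => //; rewrite -entourage_ballE; exists e.
move: entE; rewrite -entourage_ballE => -[e /= e0 eE].
have := H e e0; apply: filterS => N HN; apply: EP => y Ay; apply: eE.
exact: HN.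
Qed.

Section gap_sequence.
Context {R : realType} (D : set R) (W : nat -> set R).
Hypotheses (DI : D `<=` @unitI R) (Dlim : D `<=` limit_point D).
Hypothesis (DW : gap_sequence D W).

Lemma open_gap n : open (W n).
Proof. by case: DW => /(_ n)[a [b [_ _ _ -> _]]] _ _; exact: itv_open. Qed.

Lemma closure_gap_sub n : closure (W n) `<=` @unitI R.
Proof.
case: DW => /(_ n)[a [b [ab Da Db -> _]]] _ _; rewrite closure_itvoo// => y.
have := DI Da; have := DI Db; rewrite /unitI /= !in_itv /=; lra.
Qed.

Lemma limit_point_closure_gap n x :
  closure (W n) x -> limit_point (closure (W n)) x.
Proof.
case: DW => /(_ n)[a [b [ab Da Db WE _]]] _ _.
move=> Wx; apply: (limit_pointS (@subset_closure _ (W n))).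
move: Wx; rewrite WE closure_itvoo//= in_itv /=.
exact: limit_point_itvoo.
Qed.

(** [W m] is an open neighbourhood of [x], so it meets [W n]. *)
Lemma closure_gap_uniq n m x : closure (W n) x -> W m x -> n = m.
Proof.
move=> Wn Wm; case: DW => _ _ dW.
have [y [Wny Wmy]] := Wn _ (open_nbhs_nbhs (conj (@open_gap m) Wm)).
exact: dW Wny Wmy.
Qed.

Lemma uniform_cvg_gap_series (F : R -> R) :
  (forall x, unitI x -> F y @[y --> within (@unitI R) (nbhs x)] --> F x) ->
  (forall x, D x -> F x = 0) ->
  {uniform @unitI R, (fun N x => \sum_(0 <= n < N) \1_(closure (W n)) x * F x)
    @ \oo --> F}.
Proof.
move=> cF F0; apply/uniform_cvg_distP => e e0.
have Fgap m N x : (m < N)%N -> W m x ->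
    \sum_(0 <= n < N) \1_(closure (W n)) x * F x = F x.
  move=> mN Wx; rewrite (bigD1_seq m) ?iota_uniq ?mem_index_iota//=.
  rewrite indicE mem_set ?mul1r; last exact: subset_closure.
  rewrite big1 ?addr0// => n nm; rewrite indicE memNset ?mul0r//.
  by move=> /closure_gap_uniq => /(_ _ Wx) nE; rewrite nE eqxx in nm.
have Fout m N x : (N <= m)%N -> W m x ->
    \sum_(0 <= n < N) \1_(closure (W n)) x * F x = 0.
  move=> Nm Wx; rewrite big_nat big1// => n nN; rewrite indicE memNset ?mul0r//.
  by move=> /closure_gap_uniq => /(_ _ Wx) nE; move: nN; rewrite nE ltnNge Nm.
have /compact_near_coveringP cI : compact (@unitI R) by exact: segment_compact.
pose P N x := unitI x ->
  `|F x - \sum_(0 <= n < N) \1_(closure (W n)) x * F x| < e.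
have : \forall N \near \oo, @unitI R `<=` P N.
  apply: cI => x Ix; have [Dx|nDx] := pselect (D x).
    have := cF x Ix => /cvgrPdist_lt /(_ e e0); rewrite F0// near_withinE => Fx.
    (* Near a point of [D] every [N] will do: the partial sum at [y] is either [F y] or 0, and [F y]
       itself is small. *)
    exists (([set y | unitI y -> `|0 - F y| < e] : set R), setT) => //=.
      by split=> //; exact: filterT.
    move=> [y N] /= [ye _] Iy.
    have [Dy|nDy] := pselect (D y).
      by rewrite F0// big1 ?subrr ?normr0// => n _; rewrite mulr0.
    case: DW => _ /(_ y Iy nDy)[m Wy] _.
    have [mN|Nm] := ltnP m N; first by rewrite (Fgap m)// subrr normr0.
    by rewrite (Fout m)// subr0 -normrN -sub0r; exact: ye.
  case: DW => _ /(_ x Ix nDx)[m Wx] _.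
  (* The gap around [x] is itself the neighbourhood: on it the partial sums equal [F] once [N]
     exceeds [m]. *)
  exists (W m, [set N | (m < N)%N]) => /=.
    split; first exact: open_nbhs_nbhs (conj (@open_gap m) Wx).
    exact: nbhs_infty_gt.
  by move=> [y N] /= [Wy mN] _; rewrite (Fgap m)// subrr normr0.
by apply: filterS => N H x Ix; exact: H.
Qed.

(** On [W n] the partial sums of ranks [n] and [n.+1] differ by [F], and each is within [e / 2] of
    the limit [g], whatever [g] is. *)
Lemma gap_series_terms_small (F g : R -> R) :
  {uniform @unitI R, (fun N x => \sum_(0 <= n < N) \1_(closure (W n)) x * F x)
    @ \oo --> g} ->
  forall e, 0 < e ->
  exists N, forall n x, (N <= n)%N -> W n x -> `|F x| <= e.
Proof.
move=> /uniform_cvg_distP Hg e e0.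
have e20 : 0 < e / 2 by rewrite divr_gt0.
have [N _ HN] := Hg _ e20; exists N => n x Nn Wx.
have cWx := subset_closure Wx; have Ix := closure_gap_sub cWx.
have := HN n Nn x Ix; have := HN n.+1 (leqW Nn) x Ix.
rewrite big_nat_recr//= indicE mem_set// mul1r.
set S := \sum_(_ <= _ < _) _; rewrite !ltr_norml ler_norml.
by move=> /andP[h1 h2] /andP[h3 h4]; apply/andP; split; lra.
Qed.

(** * Differentiability at points of [D] lying on no closed gap *)

Lemma near_notin_gaps N x : (forall n, ~ closure (W n) x) ->
  \forall y \near x, forall n, (n < N)%N -> ~ W n y.
Proof.
move=> Wx; elim: N => [|N IH]; first by near=> y.
have oW : nbhs x (~` closure (W N)).
  by apply: open_nbhs_nbhs; split; [exact/closed_openC/closed_closure|exact: Wx].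
near=> y => n; rewrite ltnS leq_eqVlt => /predU1P[->|nN].
  move=> /subset_closure; change ((~` closure (W N)) y); by near: y.
by move: n nN; near: y.
Unshelve. all: by end_near. Qed.

Lemma quotient_within_cvg0 (F : R -> R) (x : R) :
  D x -> (forall n, ~ closure (W n) x) ->
  (forall y, D y -> F y = 0) ->
  (forall n y, closure (W n) y -> cvg (quotient_within (@unitI R) F y)) ->
  (forall e, 0 < e -> exists N, forall n y, (N <= n)%N -> W n y ->
     `|derive_within (@unitI R) F y| <= e) ->
  quotient_within (@unitI R) F x --> 0.
Proof.
move=> Dx xW F0 cF F'0; apply/cvgrPdist_le => e e0.
have [N HN] := F'0 e e0; rewrite /dnbhs !near_withinE.
have := near_notin_gaps N xW; apply: filterS => y yW yx Iy.
rewrite sub0r normrN normf_div (F0 x)// subr0.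
rewrite ler_pdivrMr ?normr_gt0 ?subr_eq0//.
have [Dy|nDy] := pselect (D y).
  by rewrite F0// normr0 mulr_ge0// ltW.
case: (DW) => gapW /(_ y Iy nDy)[n Wy] _.
(* Points this close to [x] avoid the gaps of index below [N], so the bound on the derivative
   applies in the gap of [y]. *)
have Nn : (N <= n)%N by rewrite leqNgt; apply/negP => /yW/(_ Wy).
have [a [b [ab Da Db WE WD]]] := gapW n.
have cFn z : a <= z <= b -> cvg (quotient_within (@unitI R) F z).
  by move=> zab; apply: (cF n); rewrite WE closure_itvoo//= in_itv.
have F'n z : a < z < b -> `|derive_within (@unitI R) F z| <= e.
  by move=> zab; apply: (HN n) => //; rewrite WE /= in_itv.
have abI z : a <= z <= b -> unitI z.
  by move=> zab; apply: (@closure_gap_sub n); rewrite WE closure_itvoo//= in_itv.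
move: Wy; rewrite WE /= in_itv /= => /andP[ay yb].
have nxab : ~ (a < x < b).
  by move=> xab; apply: (WD x) => //; rewrite WE /= in_itv.
(* The end of the gap facing [x] is [a] if [x < y] and [b] otherwise. It lies between [x] and [y],
   so [e] times its distance to [y] is at most [e] times [|y - x|]. *)
have [xy|xy] := ltP x y.
  have xa : x <= a by rewrite leNgt; apply/negP => ax; apply: nxab; rewrite ax; lra.
  have := @within_mean_value_bound R (@unitI R) F a y e ay.
  rewrite (F0 a)// subr0 => H; apply: (le_trans (H _ _ _)).
  - by move=> z /=; rewrite in_itv /= => zay; apply: abI; lra.
  - by move=> z zay; apply: cFn; lra.
  - by move=> z zay; apply: F'n; lra.
  - by rewrite ler_pM2l// ger0_norm; lra.
have bx : b <= x by rewrite leNgt; apply/negP => bx; apply: nxab; rewrite bx; lra.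
have := @within_mean_value_bound R (@unitI R) F y b e yb.
rewrite (F0 b)// sub0r normrN => H; apply: (le_trans (H _ _ _)).
- by move=> z /=; rewrite in_itv /= => zay; apply: abI; lra.
- by move=> z zay; apply: cFn; lra.
- by move=> z zay; apply: F'n; lra.
- by rewrite ler_pM2l// ler0_norm; lra.
Qed.

(** * Sign conditions on gaps close to points of [D] *)

Lemma limit_point_three x e : D x -> 0 < e ->
  exists d1 d2 d3, [/\ D d1, D d2, D d3, x - e < d1 < d2 & d2 < d3 < x + e].
Proof.
move=> Dx e0.
have [y [yx Dy]] := Dlim Dx (nbhsx_ballx x e e0).
rewrite /ball /= => /ltr_normlP[ye1 ye2].
have d0 : 0 < `|y - x| by rewrite normr_gt0 subr_eq0.
(* Taking [z] strictly closer to [x] than [y] makes [z] differ from [y]; [x] itself is the third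
   point, and the order depends on the sides of [y] and [z]. *)
have [z [zx Dz]] := Dlim Dx (nbhsx_ballx x _ d0).
rewrite /ball /= => /ltr_normlP[ze1 ze2].
move: yx zx; rewrite !neq_lt => /orP[yx|xy] /orP[zx|xz].
- move: ze1 ze2; rewrite ltr0_norm ?subr_lt0// => ze1 ze2.
  by exists y, z, x; split => //; apply/andP; split; lra.
- move: ze1 ze2; rewrite ltr0_norm ?subr_lt0// => ze1 ze2.
  by exists y, x, z; split => //; apply/andP; split; lra.
- move: ze1 ze2; rewrite gtr0_norm ?subr_gt0// => ze1 ze2.
  by exists z, x, y; split => //; apply/andP; split; lra.
- move: ze1 ze2; rewrite gtr0_norm ?subr_gt0// => ze1 ze2.
  by exists x, z, y; split => //; apply/andP; split; lra.
Qed.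

Lemma closure_gaps_near (V : set R) x e :
  D `<=` closure (\bigcup_(n in [set n | W n `&` V !=set0]) W n) ->
  D x -> 0 < e -> exists y, [/\ unitI y, V y & `|x - y| < e].
Proof.
move=> DV Dx e0.
have [d1 [d2 [d3 [Dd1 Dd2 Dd3 /andP[d12 ?] /andP[? d23]]]]] :=
  limit_point_three Dx e0.
have d2n : nbhs d2 `]d1, d3[%classic.
  apply: open_nbhs_nbhs; split; first exact: itv_open.
  by rewrite /= in_itv /=; apply/andP.
(* Density is applied at the middle point [d2]: [z] shows that the gap meets []d1, d3[], while [y]
   is its point in [V], so far anywhere in the gap. *)
have [z [[n /= [y [Wny Vy]] Wnz]]] := DV _ Dd2 _ d2n.
rewrite /= in_itv /= => /andP[d1z zd3].
exists y; split => //; first exact/closure_gap_sub/subset_closure/Wny.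
case: DW => /(_ n)[a [b [ab Da Db WE WD]]] _ _.
move: Wny Wnz; rewrite WE /= !in_itv /= => /andP[ay yb] /andP[az zb].
have d1a : d1 <= a.
  rewrite leNgt; apply/negP => ad; apply: (WD d1) => //.
  by rewrite WE /= in_itv /= ad; lra.
have bd3 : b <= d3.
  rewrite leNgt; apply/negP => bd; apply: (WD d3) => //.
  by rewrite WE /= in_itv /= bd andbT; lra.
by rewrite ltr_norml; apply/andP; split; lra.
Qed.

(** A point of [V] near [x] is outside [D], so it lies in some gap, which then meets [V]. *)
Lemma closure_gapsP (V : set R) x : (forall y, D y -> ~ V y) ->
  (forall U, nbhs x U -> exists y, [/\ unitI y, V y & U y]) ->
  closure (\bigcup_(n in [set n | W n `&` V !=set0]) W n) x.
Proof.
move=> VD H U /H[y [Iy Vy Uy]].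
have nDy : ~ D y by move=> /VD.
case: DW => _ /(_ y Iy nDy)[n Wy] _.
by exists y; split => //; exists n => //=; exists y.
Qed.

End gap_sequence.

(** * The equivalence *)

Theorem theorem3p1 (R : realType) (f : R -> R) (D : set R) (W : nat -> set R)
    (D_cantor : cantor_set D) (D_sub : D `<=` @unitI R) (D0 : D 0) (D1 : D 1)
    (W_inj : injective W)
    (W_comp : range W =
       [set connected_component (@unitI R `\` D) x | x in @unitI R `\` D]) :
  smooth_on (@unitI R) f /\ D `<=` cutting_set f <->
  [/\ forall x, D x -> f x = 0,
      forall n, smooth_on (closure (W n)) f &
      forall p, unif_cvg_derive_series W f p] /\
  D `<=` closure (\bigcup_(n in [set n | W n `&` f @^-1` `]-oo, 0[ !=set0]) W n)
     `&` closure (\bigcup_(n in [set n | W n `&` f @^-1` `]0, +oo[ !=set0]) W n).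
Proof.
have [_ [cD DE] _ _] := D_cantor.
have Dlim : D `<=` limit_point D by rewrite DE.
have DW := gap_sequence_components cD D_sub D0 D1 W_inj W_comp.
split=> [[fS fcut]|[[f0 _ fser] fgap]].
  have f0 p x : D x -> nderive_within (@unitI R) p f x = 0.
    elim: p x => [|p IH] x Dx; first by have [_ []] := fcut x Dx.
    apply: (derive_within_eq0 D_sub (Dlim _ Dx) Dx IH).
    exact: (fS p.+1 x (D_sub x Dx)).2.
  split; first split.
  - exact: f0 0%N.
  - move=> n p x Wx.
    have WI := @closure_gap_sub _ _ _ D_sub DW n.
    have Wlim y : closure (W n) y -> limit_point (closure (W n)) y.
      by move=> Wy; exact: (limit_point_closure_gap DW Wy).
    exact: (nderive_withinS WI Wlim fS p Wx).1.
  - move=> p; split.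
      by move=> n x Wx; exact/fS/(closure_gap_sub D_sub DW Wx).
    (* The sum of the series is the derivative of order [p] itself, continuous because the one of
       order [p.+1] exists. *)
    exists (nderive_within (@unitI R) p f).
    apply: (uniform_cvg_gap_series DW) => [x Ix|]; last exact: f0.
    exact: quotient_within_continuous (fS p.+1 x Ix).2.
  - move=> x Dx; have [_ [_ cutx]] := fcut x Dx.
    split; apply: (closure_gapsP DW).
    + by move=> y /(f0 0%N) /= ->; rewrite /= in_itv /= ltxx.
    + move=> U xU; have [|y [z [[Uy Iy] _ fy _]]] := cutx U; last first.
        by exists y; split => //; rewrite /= in_itv.
      by apply: filterS xU => y Uy _.
    + by move=> y /(f0 0%N) /= ->; rewrite /= in_itv /= ltxx.
    + move=> U xU; have [|y [z [_ [Uz Iz] _ fz]]] := cutx U; last first.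
        by exists z; split => //; rewrite /= in_itv /= andbT.
      by apply: filterS xU => y Uy _.
split; last first.
  move=> x Dx; split; first exact: D_sub.
  split=> [|U]; first exact: f0.
  rewrite /within /= => /nbhs_ballP[e /= e0 eU].
  have [y [Iy fy xy]] : exists y, [/\ unitI y, (f @^-1` `]-oo, 0[) y & `|x - y| < e].
    by apply: (closure_gaps_near D_sub Dlim DW _ Dx e0) => z /fgap[].
  have [z [Iz fz xz]] : exists z, [/\ unitI z, (f @^-1` `]0, +oo[) z & `|x - z| < e].
    by apply: (closure_gaps_near D_sub Dlim DW _ Dx e0) => z /fgap[].
  move: fy fz; rewrite /= !in_itv /= andbT => fy fz.
  by exists y, z; split => //; split => //; exact: eU.
(* Vanishing on [D] is carried along with existence, since it is what gives the next derivative at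
   points of [D]. *)
suff fS p : (forall x, unitI x -> nderivable_within (@unitI R) p f x) /\
    (forall x, D x -> nderive_within (@unitI R) p f x = 0).
  by move=> p; exact: (fS p).1.
elim: p => [|p [dp p0]]; first by split.
set F := nderive_within _ p f in p0.
have cF x : unitI x -> cvg (quotient_within (@unitI R) F x).
  move=> Ix.
  (* At the ends of a gap too, the terms of the series involve the derivative relative to the whole
     unit interval, so its existence there is part of the assumption. *)
  have cgap n y : closure (W n) y -> cvg (quotient_within (@unitI R) F y).
    by move=> /(fser p.+1).1[].
  have [[n Wx]|nWx] := pselect (exists n, closure (W n) x); first exact: cgap Wx.
  have Wx n : ~ closure (W n) x by move=> Wx; apply: nWx; exists n.
  have Dx : D x.
    apply: contrapT => nDx; case: DW => _ /(_ x Ix nDx)[n Wnx] _.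
    by apply: (Wx n); exact: subset_closure.
  have [_ [g ug]] := fser p.+1.
  apply: cvgP; apply: (quotient_within_cvg0 D_sub DW Dx Wx p0 cgap).
  exact: (gap_series_terms_small D_sub DW ug).
split=> x.
  move=> Ix; split; last exact: cF.
  by rewrite near_withinE; near=> y => Iy; exact: dp.
move=> Dx; apply: (derive_within_eq0 D_sub (Dlim x Dx) Dx p0).
exact/cF/D_sub.
Unshelve. all: by end_near. Qed.
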